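(* Assume that $\chi^{-1}(a)$ is a primitive $n$-th root of unity, where $n\geq 2$. (a) If $I=\langle x^n\rangle$, then $\{V_t(\lambda)\mid\lambda\in\widehat{G},1\leq t\leq n\}$ is a representative set of isomorphism classes of finite dimensional indecomposable objects in $\mathcal{W}'$. Moreover, $V_n(\lambda)$ is a projective object in $\mathcal{W}'$ for all $\lambda\in\widehat{G}$. (b) If $I=\langle x^n-\beta(1-a^n)\rangle$ with $\beta\in k^{\times}$, $a^n\neq 1$ and $n=|\chi|$, then $$\left\{V_t(\lambda),\ V(\sigma,\beta(1-\sigma(a)^n))\ \middle|\ 1\leq t\leq n,\ \lambda\in\widehat{G}\text{ with }\lambda(a)^n=1,\ [\sigma]\in\widehat{G}/\langle\chi\rangle\text{ with }\sigma(a)^n\neq 1\right\}$$ (one $\sigma$ being chosen in each class $[\sigma]$) is a representative set of isomorphism classes of finite dimensional indecomposable objects in $\mathcal{W}'$. Moreover, $V(\lambda,\beta(1-\lambda(a)^n))$ is a projective object in $\mathcal{W}'$ for any $\lambda\in\widehat{G}$.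
   Context: $k$ is a field, $G$ a group, $\widehat{G}$ the group of characters $G\to k^{\times}$, $\chi\in\widehat{G}$ of order $|\chi|$ (possibly $\infty$), and $a\in Z(G)$ with $\chi(a)\neq 1$. $H=kG(\chi^{-1},a,0)$ is the Hopf algebra generated as an algebra by $G$ and $x$ with relations $xg=\chi^{-1}(g)gx$ ($g\in G$), having $k$-basis $\{gx^i\mid g\in G,i\geq 0\}$, with $\Delta(x)=x\otimes a+1\otimes x$, $\varepsilon(x)=0$, $S(x)=-xa^{-1}$, and each $g\in G$ group-like. $\langle\chi\rangle$ is the subgroup of $\widehat{G}$ generated by $\chi$ and $[\sigma]$ is the class of $\sigma$ in $\widehat{G}/\langle\chi\rangle$. $H'=H/I$ is a rank one pointed quotient Hopf algebra of $H$; when $\chi^{-1}(a)$ is a primitive $n$-th root of unity with $n\geq 2$, the Hopf ideal $I$ is either $\langle x^n\rangle$, or $\langle x^n-\beta(1-a^n)\rangle$ with $\beta\in k^{\times}$, $a^n\neq 1$ and $|\chi|=n$. An $H'$-module is the same as an $H$-module $M$ with $I\cdot M=0$. For an $H$-module $M$ and $\lambda\in\widehat{G}$, $M_{(\lambda)}=\{v\in M\mid g\cdot v=\lambda(g)v\ \forall g\in G\}$; $M$ is a weight module if $M=\bigoplus_{\lambda\in\widehat{G}}M_{(\lambda)}$. $\mathcal{W}'$ is the category of all (not necessarily finite dimensional) $H'$-modules that are weight modules. For $t\geq 1$ and $\lambda\in\widehat{G}$, $V_t(\lambda)$ is the $t$-dimensional $H$-module with $k$-basis $m_0,\dots,m_{t-1}$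 and action $g\cdot m_i=\chi^i(g)\lambda(g)m_i$; $x\cdot m_i=m_{i+1}$ for $0\leq i\leq t-2$; $x\cdot m_{t-1}=0$. If $|\chi|=s<\infty$, $\lambda\in\widehat{G}$ and $\gamma\in k$, then $V(\lambda,\gamma)$ is the $H$-module with $k$-basis $m_0,\dots,m_{s-1}$ and action $g\cdot m_i=\chi^i(g)\lambda(g)m_i$; $x\cdot m_i=m_{i+1}$ for $0\leq i\leq s-2$; $x\cdot m_{s-1}=\gamma m_0$. *)

(* Defs.v *)
From HB Require Import structures.
From mathcomp Require Import all_boot all_order all_algebra.
From mathcomp Require Import finmap monalg.

Set Implicit Arguments.
Unset Strict Implicit.
Unset Printing Implicit Defensive.

Import GRing.Theory.
Local Open Scope ring_scope.

(* The group \hat G of characters G -> k^*. Values in k suffice: a            *)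
(* multiplicative unital map on a group has invertible values (gchar_neq0).   *)
Record gchar (k : fieldType) (G : groupType) := GChar {
  gchar_fun :> G -> k;
  gchar1 : gchar_fun 1%g = 1;
  gcharM : forall g h : G, gchar_fun (g * h)%g = gchar_fun g * gchar_fun h }.

Section Characters.
Context {k : fieldType} {G : groupType}.
Implicit Types (chi lam sigma tau : gchar k G) (g h : G).

Lemma gchar_neq0 chi g : chi g != 0.
Proof.
apply/eqP => chig0; have := gchar1 chi.
by rewrite -(mulgV g) gcharM chig0 mul0r => /esym/eqP; rewrite oner_eq0.
Qed.

Definition gchar_order chi (n : nat) : Prop :=
  [/\ (0 < n)%N,
      forall g, chi g ^+ n = 1
    & forall m, (0 < m < n)%N -> ~ (forall g, chi g ^+ m = 1)].

Lemma gchar_order_exp chi n : gchar_order chi n -> forall g, chi g ^+ n = 1.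
Proof. by case. Qed.

(* [sigma] = [tau] in \hat G / <chi> *)
Definition same_class chi sigma tau : Prop :=
  exists i : int, forall g, tau g = sigma g * chi g ^ i.

(* R consists of exactly one character out of each class [sigma] all of whose *)
(* members satisfy P (P is meant to be stable under multiplication by chi).   *)
Definition class_transversal chi (P R : gchar k G -> Prop) : Prop :=
  (forall sigma, R sigma -> P sigma) /\
  (forall sigma, P sigma -> exists! tau, R tau /\ same_class chi sigma tau).

End Characters.

Section LinearExtension.
Context {k : fieldType} {K : choiceType}.

Definition mlin (V : lmodType k) (F : K -> V) (h : {malg k[K]}) : V :=
  \sum_(p <- msupp h) h@_p *: F p.

Lemma mlinEw (V : lmodType k) (F : K -> V) h (d : {fset K}) :
  (msupp h `<=` d)%fset -> mlin F h = \sum_(p <- d) h@_p *: F p.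
Proof.
move=> hd; rewrite /mlin (big_fset_incl _ hd) // => p _ /mcoeff_outdom ->.
by rewrite scale0r.
Qed.

Lemma eq_mlin (V : lmodType k) (F1 F2 : K -> V) h :
  F1 =1 F2 -> mlin F1 h = mlin F2 h.
Proof. by move=> F12; apply: eq_bigr => p _; rewrite F12. Qed.

Lemma mlinD (V : lmodType k) (F : K -> V) h1 h2 :
  mlin F (h1 + h2) = mlin F h1 + mlin F h2.
Proof.
rewrite (mlinEw _ (msuppD_le h1 h2)) (mlinEw _ (fsubsetUl (msupp h1) (msupp h2))).
rewrite (mlinEw _ (fsubsetUr (msupp h1) (msupp h2))) -big_split /=.
by apply: eq_bigr => p _; rewrite mcoeffD scalerDl.
Qed.

Lemma mlinZ (V : lmodType k) (F : K -> V) c h : mlin F (c *: h) = c *: mlin F h.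
Proof.
rewrite (mlinEw _ (msuppZ_le c h)) scaler_sumr.
by apply: eq_bigr => p _; rewrite mcoeffZ scalerA.
Qed.

Lemma mlin0 (V : lmodType k) (F : K -> V) : mlin F 0 = 0.
Proof. by rewrite -(scale0r (0 : {malg k[K]})) mlinZ scale0r. Qed.

Lemma mlinU (V : lmodType k) (F : K -> V) c p : mlin F << c *g p >> = c *: F p.
Proof.
by rewrite (mlinEw _ (msuppU_le (k := p) (x := c))) big_seq_fset1 mcoeffUU.
Qed.

Lemma mlin_sum (V : lmodType k) (F : K -> V) (I : Type) (r : seq I) (E : I -> {malg k[K]}) :
  mlin F (\sum_(i <- r) E i) = \sum_(i <- r) mlin F (E i).
Proof. exact: (big_morph (mlin F) (mlinD F) (mlin0 F)). Qed.

Lemma mlinDF (V : lmodType k) (F1 F2 : K -> V) h :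
  mlin (fun p => F1 p + F2 p) h = mlin F1 h + mlin F2 h.
Proof. by rewrite -big_split; apply: eq_bigr => p _; rewrite scalerDr. Qed.

Lemma mlinZF (V : lmodType k) (F : K -> V) c h :
  mlin (fun p => c *: F p) h = c *: mlin F h.
Proof.
by rewrite /mlin scaler_sumr; apply: eq_bigr => p _; rewrite !scalerA mulrC.
Qed.

Lemma mlin_linear (V W : lmodType k) (f : {linear V -> W}) (F : K -> V) h :
  f (mlin F h) = mlin (fun p => f (F p)) h.
Proof. by rewrite linear_sum; apply: eq_bigr => p _; rewrite linearZ. Qed.

Lemma mlin_id h : mlin (fun p => << p >> : {malg k[K]}) h = h.
Proof.
rewrite [RHS]monalgE; apply: eq_bigr => p _.
by apply/malgP => q; rewrite mcoeffZ !mcoeffU mulrnAr mulr1.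
Qed.

End LinearExtension.

Lemma mlin_mlin {k : fieldType} {K L : choiceType} (V : lmodType k)
    (F : K -> V) (E : L -> {malg k[K]}) (h : {malg k[L]}) :
  mlin F (mlin E h) = mlin (fun p => mlin F (E p)) h.
Proof. by rewrite [mlin E h]/mlin mlin_sum; apply: eq_bigr => p _; rewrite mlinZ. Qed.

(* The algebra underlying the Hopf algebra kG(chi^-1, a, 0): the vector space  *)
(* with basis G * nat, where (g, i) stands for g x^i, and product             *)
(*   (g x^i) (h x^j) = chi^-1(h)^i gh x^(i+j).                                *)
(* The element a enters only the coalgebra structure, so it is not a          *)
(* parameter. HgM, Hx_HgE, Hg_HxnE and rep_mod below recover the presentation *)
(* by generators and relations.                                               *)
Definition Halg (k : fieldType) (G : groupType) (chi : gchar k G) : Type :=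
  {malg k[(G * nat)%type]}.

Section Algebra.
Context {k : fieldType} {G : groupType} (chi : gchar k G).
Local Notation K := (G * nat)%type.
Local Notation HH := (Halg chi).

HB.instance Definition _ := GRing.Lmodule.copy HH {malg k[K]}.

Definition twist (p q : K) : k := (chi q.1)^-1 ^+ p.2.
Definition basis_mul (p q : K) : K := ((p.1 * q.1)%g, (p.2 + q.2)%N).

Definition Hone : HH := << (1%g, 0%N) >>.
Definition Hmul (h1 h2 : HH) : HH :=
  mlin (fun p => mlin (fun q => twist p q *: (<< basis_mul p q >> : {malg k[K]})) h2) h1.

Fact HmulA : associative Hmul.
Proof.
move=> h1 h2 h3; rewrite /Hmul [RHS]mlin_mlin; apply: eq_mlin => p.
rewrite [LHS]mlin_mlin [RHS]mlin_mlin; apply: eq_mlin => q.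
rewrite [RHS]mlinZ mlinU scale1r -[RHS]mlinZF [LHS]mlin_mlin.
apply: eq_mlin => r.
rewrite mlinZ mlinU scale1r !scalerA /basis_mul /twist /= mulgA addnA.
by congr (_ *: _); rewrite gcharM invfM exprMn exprD [LHS]mulrC -mulrA.
Qed.

Fact Hmul1 : left_id Hone Hmul.
Proof.
move=> h; rewrite /Hmul mlinU scale1r -[RHS]mlin_id; apply: eq_mlin => -[g i].
by rewrite /twist /basis_mul /= expr0 scale1r mul1g.
Qed.

Fact H1mul : right_id Hone Hmul.
Proof.
move=> h; rewrite /Hmul -[RHS]mlin_id; apply: eq_mlin => -[g i].
by rewrite mlinU scale1r /twist /basis_mul /= gchar1 invr1 expr1n scale1r mulg1 addn0.
Qed.

Fact HmulDl : left_distributive Hmul +%R.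
Proof. by move=> h1 h2 h3; rewrite /Hmul mlinD. Qed.

Fact HmulDr : right_distributive Hmul +%R.
Proof.
by move=> h1 h2 h3; rewrite /Hmul -mlinDF; apply: eq_mlin => p; rewrite mlinD.
Qed.

Fact Hone_neq0 : Hone != 0.
Proof. by rewrite monalgU_eq0 oner_eq0. Qed.

HB.instance Definition _ :=
  GRing.Zmodule_isNzRing.Build HH HmulA Hmul1 H1mul HmulDl HmulDr Hone_neq0.

Fact HscalerAl (c : k) (u v : HH) : c *: (u * v) = (c *: u) * v.
Proof. by rewrite /GRing.mul /= /Hmul mlinZ. Qed.

HB.instance Definition _ := GRing.Lmodule_isLalgebra.Build k HH HscalerAl.

Fact HscalerAr (c : k) (u v : HH) : c *: (u * v) = u * (c *: v).
Proof.
by rewrite /GRing.mul /= /Hmul -mlinZF; apply: eq_mlin => p; rewrite mlinZ.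
Qed.

HB.instance Definition _ := GRing.Lalgebra_isAlgebra.Build k HH HscalerAr.

Definition Hg (g : G) : HH := << (g, 0%N) >>.
Definition Hx : HH := << (1%g, 1%N) >>.

Lemma HmulUU (c d : k) (p q : K) :
  (<< c *g p >> : HH) * << d *g q >> = << c * d * twist p q *g basis_mul p q >>.
Proof.
rewrite /GRing.mul /= /Hmul mlinU mlinU !scalerA; apply/malgP => r.
by rewrite mcoeffZ !mcoeffU mulrnAr mulr1.
Qed.

Lemma Hg1 : Hg 1%g = 1. Proof. by []. Qed.

Lemma HgM g h : Hg (g * h)%g = Hg g * Hg h.
Proof. by rewrite HmulUU /twist /= expr0 !mulr1. Qed.

Lemma Hx_HgE g : Hx * Hg g = (chi g)^-1 *: (Hg g * Hx).
Proof.
rewrite !HmulUU /twist /basis_mul /= expr1 expr0 mul1r !mulr1 mul1g mulg1.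
by apply/malgP => r; rewrite mcoeffZ !mcoeffU mul1r mulr_natr.
Qed.

Lemma HxnE n : Hx ^+ n = << (1%g, n) >>.
Proof.
elim: n => [//|n IHn]; rewrite exprS IHn HmulUU /twist /basis_mul /= gchar1 invr1.
by rewrite expr1 !mulr1 mulg1.
Qed.

Lemma Hg_HxnE g i : Hg g * Hx ^+ i = << (g, i) >>.
Proof. by rewrite HxnE HmulUU /twist /basis_mul /= expr0 !mulr1 mulg1. Qed.

End Algebra.

(* Operators on a vector space satisfying the defining relations of H give an *)
(* H-module, in which sum c_(g,i) g x^i acts by sum c_(g,i) rho(g) X^i.       *)
Record rep (k : fieldType) (G : groupType) (chi : gchar k G) := Rep {
  rep_space : lmodType k;
  rep_g : G -> {linear rep_space -> rep_space};
  rep_x : {linear rep_space -> rep_space};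
  rep_g1 : forall v, rep_g 1%g v = v;
  rep_gM : forall g h v, rep_g (g * h)%g v = rep_g g (rep_g h v);
  rep_xg : forall g v, rep_x (rep_g g v) = (chi g)^-1 *: rep_g g (rep_x v) }.

Definition rep_mod (k : fieldType) (G : groupType) (chi : gchar k G)
  (D : rep chi) : Type := rep_space D.

Section RepMod.
Context {k : fieldType} {G : groupType} {chi : gchar k G} (D : rep chi).
Local Notation M := (rep_mod D).

HB.instance Definition _ := GRing.Zmodule.copy M (rep_space D).

Definition rep_scale (h : Halg chi) (v : M) : M :=
  mlin (fun p : G * nat => rep_g D p.1 (iter p.2 (rep_x D) v)) h.

Lemma iter_rep_xD n (u v : rep_space D) :
  iter n (rep_x D) (u + v) = iter n (rep_x D) u + iter n (rep_x D) v.
Proof. by elim: n => //= n ->; rewrite linearD. Qed.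

Lemma iter_rep_xg n g (v : rep_space D) :
  iter n (rep_x D) (rep_g D g v) =
  (chi g)^-1 ^+ n *: rep_g D g (iter n (rep_x D) v).
Proof.
elim: n => [|n IHn]; first by rewrite expr0 scale1r.
by rewrite !iterS IHn linearZ /= rep_xg scalerA exprSr.
Qed.

Fact rep_scaleA h1 h2 v :
  rep_scale h1 (rep_scale h2 v) = rep_scale (h1 * h2) v.
Proof.
rewrite [h1 * h2]/GRing.mul /= /Hmul /rep_scale [RHS]mlin_mlin.
apply: eq_mlin => -[g i] /=; rewrite [RHS]mlin_mlin.
have -> : iter i (rep_x D) (mlin (fun p => rep_g D p.1 (iter p.2 (rep_x D) v)) h2)
  = mlin (fun p => iter i (rep_x D) (rep_g D p.1 (iter p.2 (rep_x D) v))) h2.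
  by elim: i => //= i ->; rewrite mlin_linear.
rewrite mlin_linear; apply: eq_mlin => -[g' j] /=.
rewrite mlinZ mlinU scale1r /twist /= iter_rep_xg linearZ /=; congr (_ *: _).
by rewrite iterD rep_gM.
Qed.

Fact rep_scale1 : left_id 1 rep_scale.
Proof. by move=> v; rewrite /rep_scale mlinU scale1r /= rep_g1. Qed.

Fact rep_scaleDr : right_distributive rep_scale +%R.
Proof.
move=> h u v; rewrite /rep_scale -mlinDF; apply: eq_mlin => p.
by rewrite iter_rep_xD linearD.
Qed.

Fact rep_scaleDl v : {morph rep_scale^~ v : h1 h2 / h1 + h2}.
Proof. by move=> h1 h2; rewrite /rep_scale mlinD. Qed.

HB.instance Definition _ := GRing.Zmodule_isLmodule.Build (Halg chi) M
  rep_scaleA rep_scale1 rep_scaleDr rep_scaleDl.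

Lemma rep_mod_g g (v : M) : Hg chi g *: v = rep_g D g v.
Proof. by rewrite [LHS]mlinU scale1r. Qed.

Lemma rep_mod_x (v : M) : Hx chi *: v = rep_x D v.
Proof. by rewrite [LHS]mlinU scale1r /= rep_g1. Qed.

Lemma rep_mod_k (c : k) (v : M) : c%:A *: v = (c *: (v : rep_space D) : M).
Proof. by rewrite [LHS]mlinZ mlinU scale1r /= rep_g1. Qed.

End RepMod.

(* The modules with basis m_0, ..., m_(t-1), m_i the i-th unit row vector,    *)
(* where g m_i = chi^i(g) lam(g) m_i and x m_i is the i-th row of N.          *)
Section CyclicModules.
Context {k : fieldType} {G : groupType} (chi : gchar k G).

Definition weight_mx (t : nat) (lam : gchar k G) (g : G) : 'M[k]_t :=
  diag_mx (\row_i (chi g ^+ i * lam g)).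

Definition shift_mx (t : nat) (gam : k) : 'M[k]_t :=
  \matrix_(i, j) (if j == i.+1 :> nat then 1
                  else if (i.+1 == t) && (j == 0 :> nat) then gam else 0).

Definition weight_op t lam g : {linear 'rV[k]_t -> 'rV[k]_t} :=
  mulmxr (weight_mx t lam g).
Definition shift_op t gam : {linear 'rV[k]_t -> 'rV[k]_t} :=
  mulmxr (shift_mx t gam).

Fact weight_op1 t lam v : weight_op t lam 1%g v = v.
Proof.
apply/rowP => i; rewrite /= /weight_mx mul_mx_diag !mxE !gchar1 expr1n.
by rewrite !mulr1.
Qed.

Fact weight_opM t lam g h v :
  weight_op t lam (g * h)%g v = weight_op t lam g (weight_op t lam h v).
Proof.
apply/rowP => i; rewrite /= /weight_mx !mul_mx_diag !mxE !gcharM exprMn.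
by rewrite mulrACA -[RHS]mulrA; congr (_ * _); rewrite mulrC.
Qed.

Fact shift_weight t lam gam g v : gam = 0 \/ chi g ^+ t = 1 ->
  shift_op t gam (weight_op t lam g v) =
  (chi g)^-1 *: weight_op t lam g (shift_op t gam v).
Proof.
move=> Hgam; rewrite /= /weight_mx !mul_mx_diag; apply/rowP => j; rewrite !mxE.
rewrite mulr_suml mulr_sumr; apply: eq_bigr => i _; rewrite !mxE.
have chi0 := gchar_neq0 chi g.
case: (eqVneq (j : nat) i.+1) => [->|_].
  by rewrite !mulr1 exprS [RHS]mulrCA -[chi g * _ * _]mulrA mulKf.
case: andP => [[/eqP it /eqP ->]|_]; last by rewrite !mulr0 mul0r mulr0.
case: Hgam => [->|chit]; first by rewrite !mulr0 mul0r mulr0.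
rewrite expr0 mul1r; have -> : chi g ^+ i = (chi g)^-1.
  by apply: (mulfI chi0); rewrite -exprS it chit divff.
by rewrite -!mulrA mulrCA; congr (_ * (_ * _)); rewrite mulrC.
Qed.

Definition V_t_rep (t : nat) (lam : gchar k G) : rep chi :=
  @Rep k G chi 'rV[k]_t (weight_op t lam) (shift_op t 0)
    (weight_op1 lam) (weight_opM lam)
    (fun g v => shift_weight lam v (or_introl erefl)).

Definition V_gam_rep (s : nat) (chi_s : gchar_order chi s)
    (lam : gchar k G) (gam : k) : rep chi :=
  @Rep k G chi 'rV[k]_s (weight_op s lam) (shift_op s gam)
    (weight_op1 lam) (weight_opM lam)
    (fun g v => shift_weight lam v (or_intror (gchar_order_exp chi_s g))).

Definition V_t (t : nat) (lam : gchar k G) : lmodType (Halg chi) :=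
  rep_mod (V_t_rep t lam).

Definition V_gam (s : nat) (chi_s : gchar_order chi s)
    (lam : gchar k G) (gam : k) : lmodType (Halg chi) :=
  rep_mod (V_gam_rep chi_s lam gam).

Lemma weight_op_delta t lam g (i : 'I_t) :
  weight_op t lam g (delta_mx 0 i) = (chi g ^+ i * lam g) *: delta_mx 0 i.
Proof.
apply/rowP => j; rewrite /= /weight_mx mul_mx_diag !mxE eqxx /=.
by case: eqVneq => [->|_]; rewrite ?mul1r ?mulr1 // mul0r mulr0.
Qed.

Lemma shift_op_delta t gam (i j : 'I_t) : j = i.+1 :> nat ->
  shift_op t gam (delta_mx 0 i) = delta_mx 0 j.
Proof.
move=> ji; rewrite /= -rowE; apply/rowP => l; rewrite !mxE -ji eqxx /=.
rewrite -val_eqE /=; case: eqP => // _.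
by have := ltn_ord j; rewrite ltn_neqAle => /andP[/negbTE->].
Qed.

Lemma shift_op_delta_last t gam (i j : 'I_t) :
  i.+1 = t -> j = 0%N :> nat ->
  shift_op t gam (delta_mx 0 i) = gam *: delta_mx 0 j.
Proof.
move=> it j0; rewrite /= -rowE; apply/rowP => l; rewrite !mxE it eqxx /=.
rewrite -val_eqE /= j0; case: eqP => [lt|_].
  by have := ltn_ord l; rewrite lt ltnn.
by case: eqP; rewrite ?mulr1 ?mulr0.
Qed.

End CyclicModules.

Section Modules.
Context {k : fieldType} {G : groupType} {chi : gchar k G}.
Local Notation HH := (Halg chi).

Definition ideal_gen (f h : HH) : Prop :=
  exists s : seq (HH * HH), h = \sum_(p <- s) p.1 * f * p.2.

Definition weight_vector (M : lmodType HH) (lam : gchar k G) (v : M) : Prop :=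
  forall g, Hg chi g *: v = (lam g)%:A *: v.

(* M is the direct sum of its weight spaces *)
Definition weight_module (M : lmodType HH) : Prop :=
  (forall v : M, exists (n : nat) (lam : 'I_n -> gchar k G) (w : 'I_n -> M),
     (forall i, weight_vector (lam i) (w i)) /\ v = \sum_i w i) /\
  (forall (n : nat) (lam : 'I_n -> gchar k G) (w : 'I_n -> M),
     injective lam -> (forall i, weight_vector (lam i) (w i)) ->
     \sum_i w i = 0 -> forall i, w i = 0).

(* The objects of W' for I = <f>: modules over H' = H / I are H-modules       *)
(* killed by I, with the same morphisms, so W' is a full subcategory of the   *)
(* category of H-modules.                                                     *)
Definition in_W' (f : HH) (M : lmodType HH) : Prop :=
  (forall h, ideal_gen f h -> forall v : M, h *: v = 0) /\ weight_module M.

Definition fin_dim (M : lmodType HH) : Prop :=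
  exists (n : nat) (e : 'I_n -> M), forall v : M,
    exists c : 'I_n -> k, v = \sum_i (c i)%:A *: e i.

Definition iso (M N : lmodType HH) : Prop :=
  exists f : {linear M -> N}, bijective f.

(* In the next definitions C stands for (the objects of) a full subcategory.  *)
Definition indecomposable (C : lmodType HH -> Prop) (M : lmodType HH) : Prop :=
  [/\ C M, exists v : M, v != 0
    & forall A B : lmodType HH, C A -> C B -> iso M (A * B)%type ->
        (forall u : A, u = 0) \/ (forall u : B, u = 0)].

Definition epi (C : lmodType HH -> Prop) (M N : lmodType HH)
    (p : {linear M -> N}) : Prop :=
  forall P : lmodType HH, C P -> forall u v : {linear N -> P},
    u \o p =1 v \o p -> u =1 v.

Definition projective (C : lmodType HH -> Prop) (P : lmodType HH) : Prop :=
  C P /\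
  forall M N : lmodType HH, C M -> C N ->
  forall p : {linear M -> N}, epi C p ->
  forall q : {linear P -> N}, exists r : {linear P -> M}, p \o r =1 q.

(* {V i | i in J} is a representative set of isomorphism classes of C: every  *)
(* V i is in C, and every module in C is isomorphic to V i for exactly one i. *)
Definition representative_set (T : Type) (J : T -> Prop)
    (V : T -> lmodType HH) (C : lmodType HH -> Prop) : Prop :=
  (forall i, J i -> C (V i)) /\
  (forall M, C M -> exists! i, J i /\ iso M (V i)).

End Modules.

(* Main.v *)
Require Import Defs.
From HB Require Import structures.
From mathcomp Require Import all_boot all_order all_algebra.
From mathcomp Require Import finmap monalg boolp.

Set Implicit Arguments.
Unset Strict Implicit.
Unset Printing Implicit Defensive.

Import GRing.Theory.
Local Open Scope ring_scope.

(** Write [m_0] for the generator of [V_t(lam)] or of [V(lam, gam)].  Both are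
    the module [V] with basis [m_0, ..., m_s], [s = t - 1], in which
    [x^t m_0 = gam m_0], with [gam = 0] for [V_t(lam)].  As [chi(a)^-1] is a
    primitive [n]-th root of unity and [t <= n], the values [chi(a)^i], [i < t],
    are distinct, so the weights [lam chi^i] of the basis are distinct.

    Three facts about [V] carry the proof.
    - Out of [V] ([cyclic_out_exists]): a weight [lam] vector [m] of [M] with
      [x^t m = gam m] gives a homomorphism [V -> M] sending [m_0] to [m].
    - Into [V] ([cyclic_in_exists]): a linear form [phi] on [M] that is an
      eigenvector of weight [lam chi^s] for [G], and for which [x^t] acts as
      [gam], gives the homomorphism [u |-> \sum_i phi(x^(s-i) u) m_i].
    - Endomorphisms ([cyclic_End]): the weight [lam] part of [V] is the line of
      [m_0], so all endomorphisms are scalars, whence [V] is indecomposable.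

    Projectivity follows from the first fact: a categorical epimorphism [M -> N]
    of W' is surjective because its cokernel lies in W' ([epi_surj]), the image
    of [m_0] in [N] lifts to a vector of weight [lam] in [M]
    ([weight_component]), and the relation [x^n = 0], resp.
    [x^n = beta (1 - a^n)], of [M] makes that lift satisfy [x^n m = gam m].

    For the classification, let [M] be finite dimensional and indecomposable and
    let [m] be a weight [lam] vector of [M] with [x^t m = gam m] and
    [x^s m <> 0].  A basis of weight vectors of [M] yields a form [phi] of weight
    [lam chi^s] with [phi(x^s m) = 1] ([weight_form_exists]).  The composite
    [V -> M -> V] fixes [m_0], since [phi(x^(s-i) m)] vanishes for [i > 0] by
    comparison of weights; so [V] is a direct summand and [M] is isomorphic to
    [V] ([indecomposable_cyclic]).  If [x^n M = 0], such an [m] exists with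
    [gam = 0] and [s] maximal such that [x^s M <> 0].  Otherwise, in the deformed
    case, [M] has a weight vector of weight [sigma] with [sigma(a)^n <> 1], on
    which [x^n] acts by the nonzero scalar [beta (1 - sigma(a)^n)]; applying a
    power of [x] to it moves [sigma] to the chosen representative of its class,
    and one takes [t = n].

    The listed modules are pairwise not isomorphic: [t] is the nilpotency index
    of [x], the weight of [m_0] is that of [V / x V] when [gam = 0], the weights
    of [V(sigma, gam)] lie in the class of [sigma], and [x^n] tells the two
    families apart. *)

(** * Characters *)

Section Characters.
Context {k : fieldType} {G : groupType}.
Implicit Types lam mu chi : gchar k G.

Lemma gchar_ext lam mu : lam =1 mu -> lam = mu.
Proof.
case: lam mu => [f f1 fM] [g g1 gM] /= /funext fg; subst g.
by congr GChar; exact: Prop_irrelevance.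
Qed.

Lemma gchar_neq lam mu : lam <> mu -> exists g, lam g != mu g.
Proof.
move=> neq; apply/not_existsP => all_eq; apply: neq; apply: gchar_ext => g.
by apply/eqP/negPn/negP; exact: all_eq.
Qed.

Fact gchar_twist1 chi lam i : chi 1%g ^+ i * lam 1%g = 1.
Proof. by rewrite !gchar1 expr1n mulr1. Qed.

Fact gchar_twistM chi lam i g h :
  chi (g * h)%g ^+ i * lam (g * h)%g =
  (chi g ^+ i * lam g) * (chi h ^+ i * lam h).
Proof. by rewrite !gcharM exprMn mulrACA. Qed.

Definition gchar_twist chi i lam : gchar k G :=
  GChar (gchar_twist1 chi lam i) (gchar_twistM chi lam i).

End Characters.

(** * The actions of the ground field, of [G] and of [x] on a module *)

Section Actions.
Context {k : fieldType} {G : groupType} {chi : gchar k G}.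
Local Notation HH := (Halg chi).
Implicit Types (M N : lmodType HH) (lam mu : gchar k G).

Lemma scale_kC M (c : k) (h : HH) (v : M) : h *: (c%:A *: v) = c%:A *: (h *: v).
Proof. by rewrite !scalerA -scalerAr -scalerAl mulr1 mul1r. Qed.

Lemma scale_kA M (c d : k) (v : M) : c%:A *: (d%:A *: v) = (c * d)%:A *: v.
Proof. by rewrite scalerA -scalerAl mul1r scalerA. Qed.

Lemma scale_kD M (c d : k) (v : M) :
  (c + d)%:A *: v = c%:A *: v + d%:A *: v.
Proof. by rewrite !scalerDl. Qed.

Lemma scale_kB M (c d : k) (v : M) :
  (c - d)%:A *: v = c%:A *: v - d%:A *: v.
Proof. by rewrite !scalerBl. Qed.

Lemma scale_k0 M (v : M) : (0 : k)%:A *: v = 0.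
Proof. by rewrite !scale0r. Qed.

Lemma scale_k1 M (v : M) : (1 : k)%:A *: v = v.
Proof. by rewrite !scale1r. Qed.

Lemma scale_kN1 M (v : M) : (-1 : k)%:A *: v = - v.
Proof. by rewrite -[-1]sub0r scale_kB scale_k0 scale_k1 sub0r. Qed.

Lemma scale_k_inj M (c : k) (u v : M) : c != 0 -> c%:A *: u = c%:A *: v -> u = v.
Proof.
move=> c0 /(congr1 (fun w => (c^-1)%:A *: w)).
by rewrite !scale_kA mulVf // !scale_k1.
Qed.

Lemma Halg_monomials (h : HH) :
  h = \sum_(p <- msupp h) h@_p *: (Hg chi p.1 * Hx chi ^+ p.2).
Proof.
rewrite -[LHS]mlin_id; apply: eq_bigr => -[g i] _ /=.
by rewrite Hg_HxnE.
Qed.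

(** The monomials [g x^i] span [H], so linearity over [k] and compatibility with
    [G] and [x] amount to linearity over [H]. *)
Lemma linear_of_generators M N (f : M -> N) :
  (forall u v, f (u + v) = f u + f v) ->
  (forall (c : k) v, f (c%:A *: v) = c%:A *: f v) ->
  (forall g v, f (Hg chi g *: v) = Hg chi g *: f v) ->
  (forall v, f (Hx chi *: v) = Hx chi *: f v) ->
  linear f.
Proof.
move=> fD fk fg fx h u v; rewrite fD; congr (_ + _).
have f0 : f 0 = 0 by rewrite -[X in f X](scale_k0 0) fk scale_k0.
rewrite (Halg_monomials h) !scaler_suml (big_morph f fD f0).
apply: eq_bigr => -[g i] _ /=.
rewrite -[in LHS](mul1r (Hg chi g * _)) -[in RHS](mul1r (Hg chi g * _)).
rewrite [in LHS]scalerAl [in RHS]scalerAl -![((_ : HH) * _) *: _]scalerA.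
rewrite fk fg; congr (_ *: (_ *: _)).
by elim: i => [|i IHi]; rewrite ?expr0 ?scale1r // exprS -!scalerA fx IHi.
Qed.

Section Weights.
Context {M : lmodType HH}.
Implicit Types v w : M.

Lemma weight0 lam : weight_vector lam (0 : M).
Proof. by move=> g; rewrite !scaler0. Qed.

Lemma weightB lam v w :
  weight_vector lam v -> weight_vector lam w -> weight_vector lam (v - w).
Proof. by move=> vl wl g; rewrite !scalerBr vl wl. Qed.

Lemma weightZ lam (c : k) v :
  weight_vector lam v -> weight_vector lam (c%:A *: v).
Proof. by move=> vl g; rewrite scale_kC vl scale_kC. Qed.

Lemma weight_sum lam (I : Type) (r : seq I) (P : pred I) (w : I -> M) :
  (forall i, P i -> weight_vector lam (w i)) ->
  weight_vector lam (\sum_(i <- r | P i) w i).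
Proof.
by move=> wl g; rewrite !scaler_sumr; apply: eq_bigr => i Pi; rewrite wl.
Qed.

Lemma Hg_Hx v g : Hg chi g *: (Hx chi *: v) = (chi g)%:A *: (Hx chi *: (Hg chi g *: v)).
Proof.
rewrite [Hx chi *: (_ *: _)]scalerA Hx_HgE -(mul1r (Hg chi g * _)) scalerAl.
by rewrite -!scalerA scale_kA divff ?gchar_neq0 // scale_k1.
Qed.

Lemma Hg_Hxn v g i : Hg chi g *: (Hx chi ^+ i *: v) =
  (chi g ^+ i)%:A *: (Hx chi ^+ i *: (Hg chi g *: v)).
Proof.
elim: i => [|i IHi]; first by rewrite !expr0 scale_k1 !scale1r.
by rewrite exprS -!scalerA Hg_Hx IHi scale_kC scale_kA exprS.
Qed.

Lemma weight_Hxn lam v i :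
  weight_vector lam v -> weight_vector (gchar_twist chi i lam) (Hx chi ^+ i *: v).
Proof. by move=> vl g; rewrite Hg_Hxn vl scale_kC scale_kA. Qed.

(** This gives both the independence of the weight spaces and the lifting of
    weight vectors along surjections.  In the induction, a last term of weight [nu <> lam] is cancelled by the
    operator [g - nu(g)], where [g] separates [lam] from [nu]; this operator
    multiplies the vectors of weight [lam] by a common nonzero scalar. *)
Lemma weight_component n lam (mu : 'I_n -> gchar k G) (w : 'I_n -> M) v :
  weight_vector lam v -> (forall i, weight_vector (mu i) (w i)) ->
  v = \sum_i w i -> v = \sum_(i | `[< mu i = lam >]) w i.
Proof.
elim: n mu w v => [|n IHn] mu w v vl wmu vE; first by rewrite vE !big_ord0.
have IH := IHn (fun i => mu (widen_ord (leqnSn n) i)).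
move: vE; rewrite big_ord_recr /= => vE.
rewrite big_mkcond big_ord_recr -big_mkcond /=.
case: asboolP => [e|neq].
  rewrite -(IH _ (v - w ord_max)) ?subrK //; last by rewrite vE addrK.
  by apply: weightB => //; rewrite -e.
rewrite addr0; have [g gP] := gchar_neq (not_eq_sym neq).
have c0 : lam g - mu ord_max g != 0 by rewrite subr_eq0.
apply: (scale_k_inj c0); rewrite scaler_sumr.
have -> : \sum_(i < n | `[< mu (widen_ord (leqnSn n) i) = lam >])
    (lam g - mu ord_max g)%:A *: w (widen_ord (leqnSn n) i) =
  \sum_(i < n | `[< mu (widen_ord (leqnSn n) i) = lam >])
    (mu (widen_ord (leqnSn n) i) g - mu ord_max g)%:A *: w (widen_ord (leqnSn n) i).
  by apply: eq_bigr => i /asboolP ->.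
apply: IH => [|i|]; [exact: weightZ | exact: weightZ|].
rewrite scale_kB -vl {1 2}vE !scalerDr -wmu opprD addrACA subrr addr0.
rewrite !scaler_sumr -sumrB; apply: eq_bigr => i _.
by rewrite wmu scale_kB.
Qed.

(** Independence of the weight spaces is automatic: the zero vector has every
    weight, so each term of a vanishing sum is a weight component of zero. *)
Lemma weight_moduleP :
  (forall v, exists (n : nat) (lam : 'I_n -> gchar k G) (w : 'I_n -> M),
     (forall i, weight_vector (lam i) (w i)) /\ v = \sum_i w i) ->
  weight_module M.
Proof.
move=> span; split=> // n lam w lam_inj wl w0 i.
have := weight_component (weight0 (lam i)) wl (esym w0).
rewrite (big_pred1 i) // => j; apply/asboolP/eqP => [/lam_inj //|->] //.
Qed.

End Weights.
End Actions.

(** * Kernels and cokernels of module homomorphisms *)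

Section Kernel.
Context {R : pzRingType} {M N : lmodType R} (f : {linear M -> N}).

Definition ker_pred : {pred M} := [pred v | f v == 0].

Fact ker_submod_closed : submod_closed ker_pred.
Proof.
split=> [|c u v]; rewrite !inE ?linear0 // => /eqP fu /eqP fv.
by rewrite linearP fu fv scaler0 addr0.
Qed.

HB.instance Definition _ := GRing.isSubmodClosed.Build R M ker_pred ker_submod_closed.

Definition ker_mod : Type := {v : M | ker_pred v}.

HB.instance Definition _ := SubChoice.on ker_mod.
HB.instance Definition _ := [SubChoice_isSubLmodule of ker_mod by <:].

Lemma ker_modP (w : ker_mod) : f (val w) = 0.
Proof. by case: w => v /= /eqP. Qed.

End Kernel.

Section Cokernel.
Context {R : pzRingType} {M N : lmodType R} (p : {linear M -> N}).

Definition im_pred : {pred N} := [pred y | `[< exists x, p x = y >]].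

Fact im_zmod_closed : zmod_closed im_pred.
Proof.
split=> [|_ _ /asboolP[u <-] /asboolP[v <-]]; apply/asboolP.
  by exists 0; rewrite linear0.
by exists (u - v); rewrite linearB.
Qed.

HB.instance Definition _ := GRing.isZmodClosed.Build N im_pred im_zmod_closed.

Definition coker : Type := Quotient.quot im_pred.

HB.instance Definition _ := GRing.Zmodule.on coker.

Definition coker_proj (y : N) : coker := \pi_(Quotient.quot im_pred)%qT y.

Lemma coker_projE y z : (coker_proj y = coker_proj z) <-> exists x, p x = y - z.
Proof.
split=> [/eqP|yz].
  by rewrite /coker_proj -Quotient.idealrBE => /asboolP.
by apply/eqP; rewrite /coker_proj -Quotient.idealrBE; apply/asboolP.
Qed.

Lemma coker_projD y z : coker_proj (y + z) = coker_proj y + coker_proj z.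
Proof. exact: raddfD. Qed.

Lemma coker_proj_surj q : exists y, coker_proj y = q.
Proof. by exists (repr q); rewrite /coker_proj reprK. Qed.

(** Multiplication by [c] on the quotient, computed on the canonical
    representatives; [coker_projZ] shows independence of the representative. *)
Definition coker_scale (c : R) (q : coker) : coker := coker_proj (c *: repr q).

Lemma coker_projZ c y : coker_proj (c *: y) = coker_scale c (coker_proj y).
Proof.
apply/coker_projE.
have [x px] : exists x, p x = y - repr (coker_proj y).
  by apply/coker_projE; rewrite /coker_proj reprK.
by exists (c *: x); rewrite linearZ /= px scalerBr.
Qed.

Fact coker_scaleA c d q : coker_scale c (coker_scale d q) = coker_scale (c * d) q.
Proof. by have [y <-] := coker_proj_surj q; rewrite -!coker_projZ scalerA. Qed.

Fact coker_scale1 : left_id 1 coker_scale.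
Proof.
by move=> q; have [y <-] := coker_proj_surj q; rewrite -coker_projZ scale1r.
Qed.

Fact coker_scaleDr : right_distributive coker_scale +%R.
Proof.
move=> c q r; have [y <-] := coker_proj_surj q; have [z <-] := coker_proj_surj r.
by rewrite -coker_projD -!coker_projZ scalerDr coker_projD.
Qed.

Fact coker_scaleDl q : {morph coker_scale^~ q : c d / c + d}.
Proof.
move=> c d; have [y <-] := coker_proj_surj q.
by rewrite -!coker_projZ scalerDl coker_projD.
Qed.

HB.instance Definition _ := GRing.Zmodule_isLmodule.Build R coker
  coker_scaleA coker_scale1 coker_scaleDr coker_scaleDl.

Fact coker_proj_linear : linear coker_proj.
Proof. by move=> c y z; rewrite coker_projD coker_projZ. Qed.

HB.instance Definition _ := GRing.isLinear.Build R N coker *:%R coker_proj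
  coker_proj_linear.

End Cokernel.

(** * The category W' *)

Section Category.
Context {k : fieldType} {G : groupType} {chi : gchar k G}.
Local Notation HH := (Halg chi).
Implicit Types (M N V : lmodType HH) (f : HH).

Lemma iso_sym M N : iso M N -> iso N M.
Proof.
case=> f [g fK gK].
pose gL := HB.pack_for {linear N -> M} g
  (GRing.isLinear.Build _ _ _ _ g (can2_linear fK gK)).
by exists gL; exists f.
Qed.

Lemma iso_trans M N V : iso M N -> iso N V -> iso M V.
Proof. by case=> f fb [g gb]; exists (g \o f); exact: bij_comp. Qed.

Lemma in_W'P f M : (forall v : M, f *: v = 0) ->
  (forall v : M, exists (n : nat) (lam : 'I_n -> gchar k G) (w : 'I_n -> M),
     (forall i, weight_vector (lam i) (w i)) /\ v = \sum_i w i) ->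
  in_W' f M.
Proof.
move=> fM span; split; last exact: weight_moduleP.
move=> _ [s ->] v; rewrite scaler_suml big1_seq // => i _.
by rewrite -!scalerA fM scaler0.
Qed.

Lemma in_W'_kill f M : in_W' f M -> forall v : M, f *: v = 0.
Proof.
case=> fM _; apply: fM; exists [:: (1, 1)].
by rewrite big_seq1 /= mul1r mulr1.
Qed.

(** The objects of W' are characterised by annihilation by [f] and by being
    spanned by weight vectors; both pass to quotients, hence to summands. *)
Lemma in_W'_image f M N (p : {linear M -> N}) :
  (forall y, exists x, p x = y) -> in_W' f M -> in_W' f N.
Proof.
move=> p_surj WM; have fM := in_W'_kill WM; case: WM => _ [span _].
apply: in_W'P => y; have [x <-] := p_surj y; first by rewrite -linearZ fM linear0.
have [n [lam [w [wl ->]]]] := span x.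
exists n, lam, (p \o w); split=> [i g|]; first by rewrite -!linearZ wl.
exact: linear_sum.
Qed.

(** A nonzero retract [V] of an indecomposable object [M] is all of [M], since
    the kernel of the retraction is a complement of [V] in the category. *)
Lemma indecomposable_retract f M V (i : {linear V -> M}) (r : {linear M -> V}) :
  indecomposable (in_W' f) M -> cancel i r -> (exists v : V, v != 0) -> iso M V.
Proof.
case=> WM _ indM iK [v0 v0_neq0].
(* The projection [m - i (r m)] on the kernel along the image of [i]. *)
have rest_ker m : ker_pred r (m - i (r m)).
  by apply/eqP; rewrite linearB iK subrr.
pose rest m : ker_mod r := Sub (m - i (r m)) (rest_ker m).
have rest_lin : linear rest.
  move=> c u v; apply: val_inj; rewrite [RHS]linearP /= !linearP /=.
  by rewrite scalerDr addrACA.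
pose restL := HB.pack_for {linear M -> ker_mod r} rest
  (GRing.isLinear.Build _ _ _ _ rest rest_lin).
have WV : in_W' f V.
  by apply: (in_W'_image (p := r)) WM => v; exists (i v); rewrite iK.
have WK : in_W' f (ker_mod r).
  apply: (in_W'_image (p := restL)) WM => w; exists (val w).
  by apply: val_inj; rewrite /= ker_modP linear0 subr0.
pose split_ m := (r m, rest m).
have split_lin : linear split_.
  by move=> c u v; rewrite /split_ rest_lin linearP.
pose splitL := HB.pack_for {linear M -> (V * ker_mod r)%type} split_
  (GRing.isLinear.Build _ _ _ _ split_ split_lin).
have isoM : iso M (V * ker_mod r)%type.
  exists splitL; exists (fun u => i u.1 + val u.2) => [m|[u w]] /=.
    by rewrite addrC subrK.
  have rE : r (i u + val w) = u by rewrite linearD iK ker_modP addr0.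
  rewrite /= /split_ rE; congr pair.
  by apply: val_inj; rewrite /= rE addrAC subrr add0r.
have [V0|K0] := indM _ _ WV WK isoM; first by rewrite (V0 v0) eqxx in v0_neq0.
exists r; exists i => // m; apply/eqP; rewrite eq_sym -subr_eq0.
by have /(congr1 val) /= -> := K0 (rest m).
Qed.

(** Two maps out of the cokernel, the projection and zero, detect whether the
    cokernel vanishes; it lies in the category because the latter is closed
    under quotients. *)
Lemma epi_surj f M N (p : {linear M -> N}) :
  in_W' f N -> epi (in_W' f) p -> forall y, exists x, p x = y.
Proof.
move=> WN epip y.
have WC : in_W' f (coker p).
  by apply: (in_W'_image (p := coker_proj p)) WN; exact: coker_proj_surj.
have pz : coker_proj p \o p =1 \0 \o p.
  move=> x /=; rewrite -(linear0 (coker_proj p)).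
  by apply/coker_projE; exists x; rewrite subr0.
have /= := epip _ WC _ _ pz y.
by rewrite -(linear0 (coker_proj p)) => /coker_projE; rewrite subr0.
Qed.

End Category.

(** * The modules generated by one weight vector *)

(** The shift relation is kept as a hypothesis on [gam]: it holds if [gam = 0]
    and if [chi^t = 1], and this treats [V_t(lam)] and [V(lam, gam)] at once.
    The dimension is [t = s + 1], so that the generator has an index. *)

Section Cyclic.
Context {k : fieldType} {G : groupType} {chi : gchar k G}.
Local Notation HH := (Halg chi).
Variables (s : nat) (lam : gchar k G) (gam : k).
Local Notation t := s.+1.
Variable shift_weight_lam : forall g v, shift_op t gam (weight_op chi t lam g v) =
  (chi g)^-1 *: weight_op chi t lam g (shift_op t gam v).

Definition cyclic_rep : rep chi :=
  @Rep k G chi 'rV[k]_t (weight_op chi t lam) (shift_op t gam)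
    (@weight_op1 k G chi t lam) (@weight_opM k G chi t lam) shift_weight_lam.

Definition cyclic : lmodType HH := rep_mod cyclic_rep.
Local Notation V := cyclic.

Definition coeff (i : 'I_t) (v : V) : k := (v : 'rV[k]_t) 0 i.
Definition of_coeffs (c : 'I_t -> k) : V := (\row_i c i : 'rV[k]_t).
Definition gen : V := (delta_mx 0 ord0 : 'rV[k]_t).

Lemma coeff_inj u v : (forall i, coeff i u = coeff i v) -> u = v.
Proof. by move=> uv; apply/rowP. Qed.

Lemma coeff_of_coeffs c i : coeff i (of_coeffs c) = c i.
Proof. exact: mxE. Qed.

Lemma coeffD i u v : coeff i (u + v) = coeff i u + coeff i v.
Proof. exact: mxE. Qed.

Lemma coeff0 i : coeff i 0 = 0.
Proof. exact: mxE. Qed.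

Lemma coeffk i c v : coeff i (c%:A *: v) = c * coeff i v.
Proof. by rewrite /coeff rep_mod_k; exact: mxE. Qed.

Lemma coeffg i g v : coeff i (Hg chi g *: v) = chi g ^+ i * lam g * coeff i v.
Proof.
by rewrite /coeff rep_mod_g /= /weight_mx mul_mx_diag !mxE mulrC.
Qed.

Lemma Hxn_gen (i : 'I_t) : Hx chi ^+ i *: gen = (delta_mx 0 i : 'rV[k]_t).
Proof.
case: i => i; elim: i => [|i IHi] it; rewrite /gen.
  by rewrite expr0 scale1r; congr (delta_mx 0 _ : 'rV_t); apply: val_inj.
rewrite exprS -scalerA (IHi (ltnW it)) rep_mod_x.
exact: (shift_op_delta gam (i := Ordinal (ltnW it)) (j := Ordinal it)).
Qed.

Lemma cyclic_span v : v = \sum_i (coeff i v)%:A *: (Hx chi ^+ i *: gen).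
Proof.
rewrite {1}[v : 'rV[k]_t]row_sum_delta; apply: eq_bigr => i _.
by rewrite Hxn_gen rep_mod_k.
Qed.

Lemma Hxt_gen : Hx chi ^+ t *: gen = gam%:A *: gen.
Proof.
rewrite exprS -scalerA (Hxn_gen ord_max) rep_mod_x rep_mod_k.
exact: (shift_op_delta_last gam (i := ord_max) (j := ord0)).
Qed.

(** [x^t] commutes with [x], so it acts everywhere as on the generator. *)
Lemma Hxt_cyclic (v : V) : Hx chi ^+ t *: v = gam%:A *: v.
Proof.
rewrite [v]cyclic_span !scaler_sumr; apply: eq_bigr => i _.
rewrite !(scale_kC _ (Hx chi ^+ t)) [Hx chi ^+ t *: _]scalerA -exprD addnC exprD.
rewrite -scalerA Hxt_gen (scale_kC _ (Hx chi ^+ i)).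
by rewrite !scale_kA mulrC.
Qed.

Lemma weight_gen : weight_vector lam gen.
Proof.
move=> g; rewrite rep_mod_g rep_mod_k /gen.
have /= -> := weight_op_delta chi lam g (ord0 : 'I_t).
by rewrite expr0 mul1r.
Qed.

Lemma coeff_gen j : coeff j gen = (j == ord0)%:R.
Proof. by rewrite /coeff mxE eqxx. Qed.

Lemma gen_neq0 : gen != 0.
Proof.
apply/eqP => /(congr1 (coeff ord0)); rewrite coeff0 coeff_gen eqxx.
exact/eqP/oner_neq0.
Qed.

Lemma coeff_Hx0 (v : V) : coeff ord0 (Hx chi *: v) = gam * coeff ord_max v.
Proof.
rewrite /coeff rep_mod_x /= !mxE (bigD1 ord_max) //= big1 ?addr0.
  by rewrite !mxE /= eqxx mulrC.
move=> i i_max; rewrite !mxE /= eqSS andbT.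
by rewrite (negbTE (_ : i != s :> nat)) ?mulr0 //.
Qed.

Lemma coeff_HxS (v : V) (i j : 'I_t) : j = i.+1 :> nat ->
  coeff j (Hx chi *: v) = coeff i v.
Proof.
move=> ji; rewrite /coeff rep_mod_x /= !mxE (bigD1 i) //= big1 ?addr0.
  by rewrite !mxE ji eqxx mulr1.
move=> i' i'i; rewrite !mxE ji /= andbF eqSS.
by rewrite (negbTE (_ : i != i' :> nat)) ?mulr0 // eq_sym.
Qed.

Lemma cyclic_hom_ext (M : lmodType HH) (f1 f2 : {linear V -> M}) :
  f1 gen = f2 gen -> f1 =1 f2.
Proof.
move=> f12 v; rewrite [v]cyclic_span !linear_sum; apply: eq_bigr => i _.
by rewrite !linearZ /= f12.
Qed.

Section Out.
Variables (M : lmodType HH) (m : M).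
Hypothesis m_weight : weight_vector lam m.
Hypothesis m_shift : Hx chi ^+ t *: m = gam%:A *: m.

(** The submodule generated by [m] is a quotient of [V]: wrapping around at the
    last basis vector is the relation [m_shift]. *)
Definition cyclic_out (v : V) : M :=
  \sum_i (coeff i v)%:A *: (Hx chi ^+ i *: m).

Fact cyclic_out_linear : linear cyclic_out.
Proof.
apply: linear_of_generators => [u v|c v|g v|v]; rewrite /cyclic_out.
- by rewrite -big_split; apply: eq_bigr => i _; rewrite coeffD scale_kD.
- by rewrite scaler_sumr; apply: eq_bigr => i _; rewrite coeffk scale_kA.
- rewrite scaler_sumr; apply: eq_bigr => i _.
  by rewrite coeffg scale_kC (weight_Hxn i m_weight) scale_kA mulrC.
rewrite big_ord_recl big_ord_recr /= scalerDr addrC; congr (_ + _).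
  rewrite scaler_sumr; apply: eq_bigr => i _.
  rewrite (coeff_HxS v (i := widen_ord (leqnSn s) i)) //.
  by rewrite scale_kC scalerA -exprS.
rewrite coeff_Hx0 expr0 scale1r scale_kC [Hx chi *: _]scalerA -exprS m_shift.
by rewrite scale_kA mulrC.
Qed.

Lemma cyclic_out_exists : exists h : {linear V -> M}, h gen = m.
Proof.
exists (HB.pack_for {linear V -> M} cyclic_out
  (GRing.isLinear.Build _ _ _ _ cyclic_out cyclic_out_linear)) => /=.
rewrite /cyclic_out (bigD1 ord0) //= big1 => [|i i0].
  by rewrite coeff_gen scale_k1 expr0 scale1r addr0.
by rewrite coeff_gen (negbTE i0) scale_k0.
Qed.

End Out.

Section In.
Variables (M : lmodType HH) (phi : M -> k).
Hypothesis phiD : forall u v, phi (u + v) = phi u + phi v.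
Hypothesis phik : forall c u, phi (c%:A *: u) = c * phi u.
Hypothesis phi_weight : forall g u, phi (Hg chi g *: u) = chi g ^+ s * lam g * phi u.
Hypothesis phi_shift : forall u, phi (Hx chi ^+ t *: u) = gam * phi u.

(** The form [phi] is to be the last coefficient of the map into [V].  As [x]
    shifts the basis, coefficient [i] of the image of [u] is coefficient [s] of
    the image of [x^(s-i) u], which dictates the formula; at [i = 0],
    compatibility with [x] is [phi_shift]. *)
Definition cyclic_in (u : M) : V := of_coeffs (fun i => phi (Hx chi ^+ (s - i) *: u)).

Fact cyclic_in_linear : linear cyclic_in.
Proof.
apply: linear_of_generators => [u v|c v|g v|v]; apply: coeff_inj => i.
- by rewrite coeffD !coeff_of_coeffs scalerDr phiD.
- by rewrite coeffk !coeff_of_coeffs scale_kC phik.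
- rewrite coeffg !coeff_of_coeffs.
  have := Hg_Hxn v g (s - i); move/(congr1 phi); rewrite phi_weight phik => e.
  have c0 : chi g ^+ (s - i) != 0 by rewrite expf_neq0 ?gchar_neq0.
  apply: (mulfI c0); rewrite -e !mulrA -exprD subnK //.
  exact: (ltn_ord i).
rewrite coeff_of_coeffs scalerA -exprSr; case: (posnP i) => [i0|i_gt0].
  have -> : i = ord0 by apply: val_inj.
  by rewrite coeff_Hx0 coeff_of_coeffs subn0 subnn expr0 scale1r phi_shift.
have i1 : (i.-1 < t)%N by rewrite (leq_ltn_trans (leq_pred i)).
rewrite (coeff_HxS _ (i := Ordinal i1)) ?prednK // coeff_of_coeffs /=.
by rewrite -(subSn (ltn_ord i : i <= s)%N) -[in LHS](prednK i_gt0) subSS.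
Qed.

Lemma cyclic_in_exists : exists h : {linear M -> V},
  forall u i, coeff i (h u) = phi (Hx chi ^+ (s - i) *: u).
Proof.
exists (HB.pack_for {linear M -> V} cyclic_in
  (GRing.isLinear.Build _ _ _ _ cyclic_in cyclic_in_linear)) => u i.
exact: coeff_of_coeffs.
Qed.

End In.

Variable a : G.
Hypothesis chi_a : forall i, (0 < i < t)%N -> chi a ^+ i != 1.

(** Weights [lam chi^i], [i < t], are told apart by [a], so [gen] spans the
    vectors of weight [lam]. *)
Lemma weight_lam_cyclic v : weight_vector lam v -> v = (coeff ord0 v)%:A *: gen.
Proof.
move=> vl; apply: coeff_inj => i; rewrite coeffk.
rewrite coeff_gen.
have [->|i0] := eqVneq i ord0; first by rewrite mulr1.
rewrite mulr0; apply/eqP; move: (vl a) => /(congr1 (coeff i)).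
rewrite coeffg coeffk => /eqP; rewrite -subr_eq0 -mulrBl mulf_eq0.
rewrite -{2}(mul1r (lam a)) -mulrBl mulf_eq0 subr_eq0.
rewrite (negbTE (gchar_neq0 lam a)) orbF => /orP[|//].
by rewrite (negbTE (chi_a _)) // lt0n (ltn_ord i) andbT.
Qed.

(** The image of the generator has weight [lam], hence is a multiple of it. *)
Lemma cyclic_End (f : {linear V -> V}) : exists c : k, forall v, f v = c%:A *: v.
Proof.
exists (coeff ord0 (f gen)) => v; rewrite {1}[v]cyclic_span {2}[v]cyclic_span.
rewrite linear_sum scaler_sumr; apply: eq_bigr => i _.
rewrite !linearZ /= {1}[f gen]weight_lam_cyclic.
  by rewrite (scale_kC _ (Hx chi ^+ i)) [LHS]scale_kC.
by move=> g; rewrite -!linearZ weight_gen.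
Qed.

Lemma cyclic_in_W' f : (forall v : V, f *: v = 0) -> in_W' f V.
Proof.
move=> fV; apply: in_W'P => // v.
exists t, (fun i : 'I_t => gchar_twist chi i lam),
  (fun i : 'I_t => (coeff i v)%:A *: (Hx chi ^+ i *: gen)).
split=> [i|]; last exact: cyclic_span.
by apply/weightZ/weight_Hxn/weight_gen.
Qed.

Lemma cyclic_fin_dim : fin_dim V.
Proof.
exists t, (fun i : 'I_t => Hx chi ^+ i *: gen) => v.
by exists (fun i => coeff i v); exact: cyclic_span.
Qed.

(** A decomposition would give a nontrivial idempotent endomorphism, but all
    endomorphisms are scalars. *)
Lemma cyclic_indecomposable f :
  (forall v : V, f *: v = 0) -> indecomposable (in_W' f) V.
Proof.
move=> fV; split; [exact: cyclic_in_W' | by exists gen; exact: gen_neq0 |].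
move=> A B _ _ isoV; have [psi _] := iso_sym isoV.
case: isoV => h [h' hK h'K].
have hlin : linear h' := can2_linear hK h'K.
have h'0 : h' 0 = 0 by rewrite -(linear0 h) hK.
pose e v := h' ((h v).1, 0).
(* [e] is the projection on the summand [A], transported to [V]. *)
have elin : linear e.
  move=> c u v; rewrite /e linearP -hlin; congr h'.
  by congr pair; rewrite /= scaler0 addr0.
pose eL := HB.pack_for {linear V -> V} e (GRing.isLinear.Build _ _ _ _ e elin).
have [c cE] := cyclic_End eL.
have eE u : h' (u.1, 0) = c%:A *: h' u by rewrite -cE /= /e h'K.
have cc : c * c = c.
  have ee : eL (eL gen) = eL gen by rewrite /= /e h'K.
  have : (c * c)%:A *: gen = c%:A *: gen by rewrite -scale_kA -!cE.
  move/(congr1 (coeff ord0)); rewrite (coeffk _ (c * c)) (coeffk _ c).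
  by rewrite coeff_gen eqxx !mulr1.
have : c * (c - 1) = 0 by rewrite mulrBr cc mulr1 subrr.
move/eqP; rewrite mulf_eq0 subr_eq0 => /orP[] /eqP c01; [left|right] => u.
  have := eE (u, 0); rewrite /= c01 scale_k0 -h'0 => /(can_inj h'K).
  by case.
by have := eE (0, u); rewrite c01 scale_k1 => /(can_inj h'K) [].
Qed.

(** The generator's image in [N] lifts to [M] by surjectivity of [p]; the weight
    [lam] component of a lift is again a lift, and it can be taken as image of
    the generator. *)
Lemma cyclic_projective f :
  (forall v : V, f *: v = 0) ->
  (forall (M : lmodType HH) (m : M), in_W' f M -> weight_vector lam m ->
     Hx chi ^+ t *: m = gam%:A *: m) ->
  projective (in_W' f) V.
Proof.
move=> fV shiftM; split=> [|M N WM WN p epip q]; first exact: cyclic_in_W'.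
have [u pu] := epi_surj WN epip (q gen).
have [_ [/(_ u) [n [mu [w [wmu uE]]]] _]] := WM.
pose m := \sum_(i | `[< mu i = lam >]) w i.
have m_lam : weight_vector lam m.
  by apply: weight_sum => i /asboolP <-.
have pm : p m = q gen.
  rewrite /m linear_sum; apply/esym; apply: weight_component.
  - by move=> g; rewrite -!linearZ weight_gen.
  - by move=> i g; rewrite -!linearZ wmu.
  - by rewrite -pu uE linear_sum.
have [r rgen] := cyclic_out_exists m_lam (shiftM _ _ WM m_lam).
by exists r; apply: (@cyclic_hom_ext _ (p \o r) q); rewrite /= rgen.
Qed.

End Cyclic.

(** * Splitting off a cyclic submodule *)

Section WeightForms.
Context {k : fieldType} {G : groupType} {chi : gchar k G}.
Local Notation HH := (Halg chi).
Implicit Types (M : lmodType HH) (lam mu : gchar k G).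

(** The linear forms on [M] that are eigenvectors of weight [mu] under [G].  A
    plain function carries the conditions, as [k] acts on [M] through [H]. *)
Definition weight_form M mu (phi : M -> k) : Prop :=
  [/\ forall u v, phi (u + v) = phi u + phi v,
      forall c u, phi (c%:A *: u) = c * phi u
    & forall g u, phi (Hg chi g *: u) = mu g * phi u].

(** A minimal one among the spanning subfamilies of a finite family of weight
    vectors is a basis. *)
Lemma weight_basis M : fin_dim M -> weight_module M ->
  exists (T : finType) (A : {set T}) (w : T -> M) (mu : T -> gchar k G),
  [/\ forall x, weight_vector (mu x) (w x),
      forall v, exists c : T -> k, v = \sum_(x in A) (c x)%:A *: w x
    & forall c : T -> k, \sum_(x in A) (c x)%:A *: w x = 0 ->
        forall x, x \in A -> c x = 0].
Proof.
move=> [N [e e_span]] [span _].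
have /choice[d we] : forall i,
    exists d : {n : nat & (('I_n -> gchar k G) * ('I_n -> M))%type},
    (forall j, weight_vector ((tagged d).1 j) ((tagged d).2 j)) /\
    e i = \sum_j (tagged d).2 j.
  by move=> i; have [n [mu [w we]]] := span (e i); exists (existT _ n (mu, w)).
pose n i := tag (d i).
pose mu i : 'I_(n i) -> gchar k G := (tagged (d i)).1.
pose w i : 'I_(n i) -> M := (tagged (d i)).2.
pose T : finType := {i : 'I_N & 'I_(n i)}.
pose W (x : T) := w (tag x) (tagged x).
pose spans (A : {set T}) :=
  `[< forall v, exists c : T -> k, v = \sum_(x in A) (c x)%:A *: W x >].
have spansT : spans setT.
  apply/asboolP => v; have [c ->] := e_span v.
  exists (fun x => c (tag x)).
  under eq_bigr => i _ do rewrite (we i).2 scaler_sumr.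
  by rewrite sig_big_dep; apply: eq_big => // x; rewrite inE.
have [|A /minsetP[/asboolP A_span A_min]] := @ex_minset T spans; first by exists setT.
exists T, A, W, (fun x => mu (tag x) (tagged x)); split=> // [x|c c0 x0 Ax0].
  exact: (we (tag x)).1.
apply/eqP; apply: contraT => cx0.
(* A relation with nonzero coefficient at [x0] makes [x0] superfluous. *)
suff : A :\ x0 = A by move/setP/(_ x0); rewrite !inE eqxx Ax0.
apply: A_min; last exact: subsetDl.
apply/asboolP => v; have [b ->] := A_span v.
exists (fun x => b x - b x0 / c x0 * c x).
have := congr1 (fun u => (b x0 / c x0)%:A *: u) c0; rewrite scaler0 scaler_sumr => c0'.
rewrite -[LHS]subr0 -[X in _ - X]c0' -sumrB (big_setD1 x0) //=.
rewrite scale_kA divfK // subrr add0r; apply: eq_bigr => x _.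
by rewrite scale_kA scale_kB.
Qed.

(** A coordinate form in a basis of weight vectors is a weight form; its weight is
    that of every weight vector on which it does not vanish. *)
Lemma weight_form_exists M mu (m : M) : fin_dim M -> weight_module M ->
  weight_vector mu m -> m != 0 -> exists2 phi, weight_form mu phi & phi m = 1.
Proof.
move=> fdM wM mmu m0.
have [T [A [w [nu [wnu /choice[c cE] free]]]]] := weight_basis fdM wM.
have uniq (d d' : T -> k) : \sum_(x in A) (d x)%:A *: w x =
    \sum_(x in A) (d' x)%:A *: w x -> forall x, x \in A -> d x = d' x.
  move/eqP; rewrite -subr_eq0 -sumrB => /eqP dd' x xA; apply/eqP.
  rewrite -subr_eq0; apply/eqP; apply: (free (fun x => d x - d' x)) xA.
  by rewrite -[RHS]dd'; apply: eq_bigr => y _; rewrite scale_kB.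
have cD u v x : x \in A -> c (u + v) x = c u x + c v x.
  apply: (uniq (c (u + v)) (fun x => c u x + c v x)).
  rewrite -cE {1}(cE u) {1}(cE v) -big_split.
  by apply: eq_bigr => y _; rewrite scale_kD.
have ck b u x : x \in A -> c (b%:A *: u) x = b * c u x.
  apply: (uniq (c (b%:A *: u)) (fun x => b * c u x)); rewrite -cE {1}(cE u) scaler_sumr.
  by apply: eq_bigr => y _; rewrite scale_kA.
have cg g u x : x \in A -> c (Hg chi g *: u) x = nu x g * c u x.
  apply: (uniq (c (Hg chi g *: u)) (fun x => nu x g * c u x)).
  rewrite -cE {1}(cE u) scaler_sumr.
  by apply: eq_bigr => y _; rewrite scale_kC wnu scale_kA mulrC.
have [x xA cmx] : exists2 x, x \in A & c m x != 0.
  apply/not_exists2P => all0; move/eqP: m0; apply; rewrite (cE m) big1 // => x xA.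
  by have [//|/negP/negPn/eqP ->] := all0 x; rewrite scale_k0.
have nuE g : nu x g = mu g.
  by apply: (mulIf cmx); rewrite -cg // mmu ck.
exists (fun u => c u x / c m x); last by rewrite divff.
split=> [u v|b u|g u]; first by rewrite cD // mulrDl.
  by rewrite ck // mulrA.
by rewrite cg // nuE mulrA.
Qed.

End WeightForms.

Section Splitting.
Context {k : fieldType} {G : groupType} {chi : gchar k G}.
Local Notation HH := (Halg chi).
Variables (s : nat) (lam : gchar k G) (gam : k).
Variable sw : forall g v, shift_op s.+1 gam (weight_op chi s.+1 lam g v) =
  (chi g)^-1 *: weight_op chi s.+1 lam g (shift_op s.+1 gam v).
Local Notation V := (cyclic sw).
Variable a : G.
Hypothesis chi_a : forall i, (0 < i < s.+1)%N -> chi a ^+ i != 1.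

(** The vector [m] gives a map [V -> M].  It has a retraction, given by a form of
    weight [lam chi^s] that is [1] on [x^s m], and so [V] is a summand of [M]. *)
Lemma indecomposable_cyclic f (M : lmodType HH) (m : M) :
  fin_dim M -> indecomposable (in_W' f) M ->
  weight_vector lam m -> Hx chi ^+ s *: m != 0 ->
  Hx chi ^+ s.+1 *: m = gam%:A *: m ->
  (forall phi : M -> k, weight_form (gchar_twist chi s lam) phi ->
     forall u, phi (Hx chi ^+ s.+1 *: u) = gam * phi u) ->
  iso M V.
Proof.
move=> fdM indM m_lam xm_neq0 xm shift_phi; have [[_ wM] _ _] := indM.
have [phi phi_form phi1] := weight_form_exists fdM wM (weight_Hxn s m_lam) xm_neq0.
have phi_shift := shift_phi _ phi_form.
have [phiD phik phig] := phi_form.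
have [h hgen] := cyclic_out_exists sw m_lam xm.
have [r rE] := cyclic_in_exists sw phiD phik phig phi_shift.
have hK : cancel h r.
  apply: (@cyclic_hom_ext _ _ _ _ _ _ sw V (r \o h) idfun).
  rewrite /= hgen; apply: coeff_inj => i; rewrite rE coeff_gen.
  have [->|i0] := eqVneq i ord0; first by rewrite subn0.
  (* [x^(s-i) m] has weight [lam chi^(s-i)], which differs from [lam chi^s] at [a]. *)
  apply/eqP; have := phig a (Hx chi ^+ (s - i) *: m).
  rewrite (weight_Hxn _ m_lam) phik /= => /eqP.
  rewrite -subr_eq0 -mulrBl mulf_eq0 => /orP[|//].
  rewrite -mulrBl mulf_eq0 (negbTE (gchar_neq0 lam a)) orbF.
  have -> : chi a ^+ s = chi a ^+ (s - i) * chi a ^+ i.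
    by rewrite -exprD subnK //; exact: (ltn_ord i).
  rewrite -{1}(mulr1 (chi a ^+ (s - i))) -mulrBr.
  rewrite mulf_eq0 expf_eq0 (negbTE (gchar_neq0 chi a)) andbF /=.
  by rewrite subr_eq0 eq_sym (negbTE (chi_a _)) // lt0n ltn_ord andbT.
by apply: indecomposable_retract indM hK _; exists (gen sw); exact: gen_neq0.
Qed.

End Splitting.

(** * Isomorphisms between cyclic modules *)

Section Isomorphisms.
Context {k : fieldType} {G : groupType} {chi : gchar k G}.
Local Notation HH := (Halg chi).
Variables (s s' : nat) (lam lam' : gchar k G) (gam gam' : k).
Variable sw : forall g v, shift_op s.+1 gam (weight_op chi s.+1 lam g v) =
  (chi g)^-1 *: weight_op chi s.+1 lam g (shift_op s.+1 gam v).
Variable sw' : forall g v, shift_op s'.+1 gam' (weight_op chi s'.+1 lam' g v) =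
  (chi g)^-1 *: weight_op chi s'.+1 lam' g (shift_op s'.+1 gam' v).

Lemma cyclic_hom_weight (h : {linear cyclic sw -> cyclic sw'}) i :
  coeff i (h (gen sw)) != 0 -> lam = gchar_twist chi i lam'.
Proof.
move=> hi; apply: gchar_ext => g; apply: (mulIf hi).
have := congr1 (coeff i) (linearZ_LR h (Hg chi g) (gen sw)).
by rewrite /= weight_gen linearZ /= coeffk coeffg.
Qed.

(** The image of the generator has weight [lam], and a weight vector of a cyclic
    module has the weight of any basis vector occurring in it. *)
Lemma cyclic_iso_weight : iso (cyclic sw) (cyclic sw') ->
  exists i : 'I_s'.+1, lam = gchar_twist chi i lam'.
Proof.
case=> h /bij_inj h_inj.
have [i hi] : exists i, coeff i (h (gen sw)) != 0.
  apply/not_existsP => all0; move/eqP: (gen_neq0 sw); apply; apply: h_inj.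
  rewrite linear0; apply: coeff_inj => i; rewrite coeff0; apply/eqP/negPn/negP.
  exact: all0.
by exists i; exact: cyclic_hom_weight hi.
Qed.

Lemma Hxn_gen_neq0 i : (i <= s)%N -> Hx chi ^+ i *: gen sw != 0.
Proof.
move=> le_is; have := Hxn_gen sw (Ordinal (le_is : i < s.+1)%N) => /= ->.
apply/eqP => /(congr1 (fun v : 'rV_s.+1 => v 0 (Ordinal (le_is : i < s.+1)%N))).
by rewrite !mxE !eqxx; exact/eqP/oner_neq0.
Qed.

End Isomorphisms.

Section NilpotentIsomorphisms.
Context {k : fieldType} {G : groupType} {chi : gchar k G}.
Variables (s s' : nat) (lam lam' : gchar k G).
Variable sw : forall g v, shift_op s.+1 0 (weight_op chi s.+1 lam g v) =
  (chi g)^-1 *: weight_op chi s.+1 lam g (shift_op s.+1 0 v).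
Variable sw' : forall g v, shift_op s'.+1 0 (weight_op chi s'.+1 lam' g v) =
  (chi g)^-1 *: weight_op chi s'.+1 lam' g (shift_op s'.+1 0 v).

(** [x^(s'+1)] kills the second module, but not the generator of the first one if
    [s' < s]. *)
Lemma nilpotent_iso_leq : iso (cyclic sw) (cyclic sw') -> (s <= s')%N.
Proof.
case=> h /bij_inj h_inj; rewrite leqNgt; apply/negP => lt_s's.
move/eqP: (Hxn_gen_neq0 sw lt_s's); apply; apply: h_inj.
by rewrite linear0 linearZ /= Hxt_cyclic scale_k0.
Qed.

(** A vector with vanishing coefficient at the generator is killed by [x^s], and
    the image of the generator is not; so [lam'], the weight of that
    coefficient, is the weight [lam] of the image. *)
Lemma nilpotent_iso_weight : iso (cyclic sw) (cyclic sw') -> s = s' -> lam = lam'.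
Proof.
case=> h /bij_inj h_inj ss'.
have h0 : coeff ord0 (h (gen sw)) != 0.
  apply/eqP => h0; move/eqP: (Hxn_gen_neq0 sw (leqnn s)); apply; apply: h_inj.
  rewrite linear0 linearZ /= [h _]cyclic_span scaler_sumr big1 // => i _.
  have [->|i0] := eqVneq i ord0; first by rewrite h0 scale_k0 scaler0.
  have i_gt0 : (0 < i)%N by rewrite lt0n.
  have sE : (s + i = i.-1 + s'.+1)%N by rewrite ss' addnS -addSn prednK // addnC.
  rewrite scale_kC [Hx chi ^+ s *: _]scalerA -exprD sE.
  by rewrite exprD -scalerA Hxt_cyclic scale_k0 !scaler0.
rewrite (cyclic_hom_weight h0); apply: gchar_ext => g /=.
by rewrite expr0 mul1r.
Qed.

End NilpotentIsomorphisms.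

(** * The classification *)

Section Nilpotent.
Context {k : fieldType} {G : groupType} {chi : gchar k G}.
Local Notation HH := (Halg chi).
Variables (a : G) (n : nat).
Hypothesis chi_a : forall i, (0 < i < n)%N -> chi a ^+ i != 1.

Definition shift_weight0 s lam g v :
  shift_op s.+1 0 (weight_op chi s.+1 lam g v) =
  (chi g)^-1 *: weight_op chi s.+1 lam g (shift_op s.+1 0 v) :=
  shift_weight lam v (or_introl erefl).

Lemma V_t_cyclic s lam : V_t chi s.+1 lam = cyclic (shift_weight0 (s := s) lam).
Proof. by []. Qed.

Lemma V_t_kill s lam (v : V_t chi s.+1 lam) : (s < n)%N -> Hx chi ^+ n *: v = 0.
Proof.
move=> lt_sn; rewrite -(subnK lt_sn) exprD -scalerA.
have -> : Hx chi ^+ s.+1 *: v = 0 by rewrite [LHS]Hxt_cyclic scale_k0.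
exact: scaler0.
Qed.

Lemma V_t_iso_inj t t' lam lam' : (0 < t)%N -> (0 < t')%N ->
  iso (V_t chi t lam) (V_t chi t' lam') -> t = t' /\ lam = lam'.
Proof.
case: t t' => [|s] // [|s'] // _ _; rewrite !V_t_cyclic => isoV.
have ss' : s = s'.
  apply/eqP; rewrite eqn_leq (nilpotent_iso_leq isoV).
  exact: nilpotent_iso_leq (iso_sym isoV).
by split; [rewrite ss' | exact: nilpotent_iso_weight isoV ss'].
Qed.

(** Let [s] be maximal with [x^s M != 0]; a weight vector not killed by [x^s]
    generates a summand. *)
Lemma nilpotent_classification f (M : lmodType HH) :
  fin_dim M -> indecomposable (in_W' f) M -> (forall v : M, Hx chi ^+ n *: v = 0) ->
  exists s lam, [/\ (s < n)%N, exists2 m : M, weight_vector lam m & m != 0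
    & iso M (V_t chi s.+1 lam)].
Proof.
move=> fdM indM xn0; have [[_ [span _]] [v0 v0_neq0] _] := indM.
pose kills i := `[< forall v : M, Hx chi ^+ i *: v = 0 >].
have ex_kills : exists i, kills i by exists n; apply/asboolP.
case: (ex_minnP ex_kills) => -[|s] /asboolP xs0 s_min.
  by have := xs0 v0; rewrite expr0 scale1r => v00; rewrite v00 eqxx in v0_neq0.
have [v xv] : exists v : M, Hx chi ^+ s *: v != 0.
  apply/not_existsP => all0; suff /s_min : kills s by rewrite ltnn.
  by apply/asboolP => v; apply/eqP/negPn/negP; exact: all0.
have [N [mu [w [wmu vE]]]] := span v.
have [i xwi] : exists i, Hx chi ^+ s *: w i != 0.
  apply/not_existsP => all0; move/eqP: xv; apply; rewrite vE scaler_sumr big1 // => i _.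
  by apply/eqP/negPn/negP; exact: all0.
have lt_sn : (s < n)%N by apply: s_min; apply/asboolP.
exists s, (mu i); split=> //.
  by exists (w i) => //; apply: contra_neq xwi => ->; rewrite scaler0.
have chi_s j : (0 < j < s.+1)%N -> chi a ^+ j != 1.
  by case/andP=> j_gt0 lt_js; apply: chi_a; rewrite j_gt0 (leq_trans lt_js).
rewrite V_t_cyclic; apply: (indecomposable_cyclic _ chi_s fdM indM (wmu i) xwi).
- by rewrite xs0 scale_k0.
- move=> phi [_ phik _] u; rewrite xs0 mul0r.
  by rewrite -(scale_k0 (0 : M)) phik mul0r.
Qed.

End Nilpotent.

Section Deformed.
Context {k : fieldType} {G : groupType} {chi : gchar k G}.
Local Notation HH := (Halg chi).
Variables (a : G) (s : nat) (beta : k).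
Local Notation n := s.+1.
Local Notation f := (Hx chi ^+ n - beta *: (1 - Hg chi a ^+ n)).
Implicit Types lam sigma tau : gchar k G.
Variable chi_n : gchar_order chi n.

Definition deform_scalar (lam : gchar k G) : k := beta * (1 - lam a ^+ n).

Lemma deform_scale (M : lmodType HH) (v : M) :
  f *: v = Hx chi ^+ n *: v - beta%:A *: (v - Hg chi a ^+ n *: v).
Proof.
by rewrite scalerBl -{1}(mul1r (1 - _)) scalerAl -scalerA scalerBl scale1r.
Qed.

Lemma Hgn_weight (M : lmodType HH) lam (v : M) i :
  weight_vector lam v -> Hg chi a ^+ i *: v = (lam a ^+ i)%:A *: v.
Proof.
move=> vl; elim: i => [|i IHi]; first by rewrite !expr0 scale1r scale_k1.
by rewrite exprS -scalerA IHi scale_kC vl scale_kA exprSr.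
Qed.

Lemma in_W'_Hxn (M : lmodType HH) (m : M) : in_W' f M ->
  Hx chi ^+ n *: m = beta%:A *: (m - Hg chi a ^+ n *: m).
Proof.
move=> WM; have := in_W'_kill WM m.
by rewrite deform_scale => /eqP; rewrite subr_eq0 => /eqP.
Qed.

(** On vectors of weight [lam] the deformed relation reads
    [x^n = beta (1 - lam(a)^n)], so [x^n] is zero or invertible there. *)
Lemma deform_scale_weight (M : lmodType HH) lam (v : M) : weight_vector lam v ->
  f *: v = Hx chi ^+ n *: v - (deform_scalar lam)%:A *: v.
Proof.
move=> vl; rewrite deform_scale; congr (_ - _).
by rewrite (Hgn_weight _ vl) -[X in X - _%:A *: v](scale_k1 v) -scale_kB scale_kA.
Qed.

Lemma Hxn_weight (M : lmodType HH) lam (m : M) : in_W' f M ->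
  weight_vector lam m -> Hx chi ^+ n *: m = (deform_scalar lam)%:A *: m.
Proof.
move=> WM ml; have := in_W'_kill WM m.
by rewrite (deform_scale_weight ml) => /eqP; rewrite subr_eq0 => /eqP.
Qed.

(** [x] multiplies weights by [chi], whose [n]-th power is trivial. *)
Lemma deform_scalar_twist i lam :
  deform_scalar (gchar_twist chi i lam) = deform_scalar lam.
Proof.
by rewrite /deform_scalar /= exprMn exprAC (gchar_order_exp chi_n) expr1n mul1r.
Qed.

(** On [M], [x^n] is the element [beta (1 - a^n)] of the group algebra, and a
    weight form turns the group algebra action into scalars. *)
Lemma deform_weight_form (M : lmodType HH) lam i (phi : M -> k) : in_W' f M ->
  weight_form (gchar_twist chi i lam) phi ->
  forall u, phi (Hx chi ^+ n *: u) = deform_scalar lam * phi u.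
Proof.
move=> WM [phiD phik phig] u; rewrite -(deform_scalar_twist i).
rewrite (in_W'_Hxn u WM) -(scale_kN1 (_ *: u)).
rewrite phik phiD phik mulN1r /deform_scalar -mulrA mulrBl mul1r; congr (_ * (_ - _)).
elim: n u => [|j IHj] u; first by rewrite !expr0 scale1r mul1r.
by rewrite !exprS -scalerA phig IHj mulrA.
Qed.

Lemma cyclic_deform_kill r lam gam
    (sw : forall g v, shift_op r.+1 gam (weight_op chi r.+1 lam g v) =
      (chi g)^-1 *: weight_op chi r.+1 lam g (shift_op r.+1 gam v)) :
  (forall v : cyclic sw, Hx chi ^+ n *: v = (deform_scalar lam)%:A *: v) ->
  forall v : cyclic sw, f *: v = 0.
Proof.
move=> xn v; rewrite [v]cyclic_span scaler_sumr big1 // => i _.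
have wi : weight_vector (gchar_twist chi i lam)
    ((coeff i v)%:A *: (Hx chi ^+ i *: gen sw)).
  exact/weightZ/weight_Hxn/weight_gen.
by rewrite (deform_scale_weight wi) xn deform_scalar_twist subrr.
Qed.

Lemma V_gam_cyclic lam gam : V_gam chi_n lam gam =
  cyclic (fun g v => shift_weight (gam := gam) lam v
    (or_intror (gchar_order_exp chi_n g))).
Proof. by []. Qed.

Lemma V_gam_kill lam (v : V_gam chi_n lam (deform_scalar lam)) : f *: v = 0.
Proof. by apply: cyclic_deform_kill => u; rewrite Hxt_cyclic. Qed.

Lemma V_t_deform_kill r lam (v : V_t chi r.+1 lam) :
  (r < n)%N -> lam a ^+ n = 1 -> f *: v = 0.
Proof.
move=> lt_rn lam_an; apply: cyclic_deform_kill => u.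
by rewrite (V_t_kill u lt_rn) /deform_scalar lam_an subrr mulr0 scale_k0.
Qed.

Hypothesis chi_a : forall i, (0 < i < n)%N -> chi a ^+ i != 1.

Lemma V_t_object t lam : (1 <= t <= n)%N -> lam a ^+ n = 1 ->
  fin_dim (V_t chi t lam) /\ indecomposable (in_W' f) (V_t chi t lam).
Proof.
case: t => // r /= lt_rn lam_an; rewrite V_t_cyclic.
split; first exact: cyclic_fin_dim.
apply: (cyclic_indecomposable (a := a)) => [i /andP[i0 ir]|v].
  by apply: chi_a; rewrite i0 (leq_trans ir).
exact: (V_t_deform_kill v).
Qed.

Lemma V_gam_object lam :
  fin_dim (V_gam chi_n lam (deform_scalar lam)) /\
  indecomposable (in_W' f) (V_gam chi_n lam (deform_scalar lam)).
Proof.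
split; first by rewrite V_gam_cyclic; exact: cyclic_fin_dim.
rewrite V_gam_cyclic; apply: (cyclic_indecomposable (a := a)) => // v.
exact: (V_gam_kill v).
Qed.

Lemma V_gam_projective lam :
  projective (in_W' f) (V_gam chi_n lam (deform_scalar lam)).
Proof.
rewrite V_gam_cyclic; apply: cyclic_projective => [v|M m WM ml].
  exact: (V_gam_kill v).
exact: Hxn_weight.
Qed.

(** [x^n] is invertible on [m], so [x^s m] is nonzero and [m] generates a summand
    of dimension [n]. *)
Lemma V_gam_classification (M : lmodType HH) lam (m : M) :
  fin_dim M -> indecomposable (in_W' f) M ->
  weight_vector lam m -> m != 0 -> deform_scalar lam != 0 ->
  iso M (V_gam chi_n lam (deform_scalar lam)).
Proof.
move=> fdM indM ml m0 gam0; have [WM _ _] := indM.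
have xm := Hxn_weight WM ml.
rewrite V_gam_cyclic; apply: (indecomposable_cyclic _ chi_a fdM indM ml) => //.
  apply: contra_neq m0 => xsm; apply: (scale_k_inj gam0).
  by rewrite -xm exprS -scalerA xsm !scaler0.
by move=> phi phi_form u; exact: deform_weight_form WM phi_form u.
Qed.

(** [x^n] is zero on the first module and a nonzero scalar on the second. *)
Lemma V_t_V_gam_not_iso t lam sigma gam : (0 < t <= n)%N -> gam != 0 ->
  ~ iso (V_t chi t lam) (V_gam chi_n sigma gam).
Proof.
case: t => // r /= lt_rn gam0 [h /bij_inj h_inj].
move: h h_inj; rewrite V_t_cyclic => h h_inj.
have e : Hx chi ^+ n *: gen (shift_weight0 (s := r) lam) = 0 := V_t_kill _ lt_rn.
have := linearZ_LR h (Hx chi ^+ n) (gen (shift_weight0 lam)).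
rewrite e linear0 [RHS]Hxt_cyclic -[LHS](scaler0 _ (gam%:A)) => /(scale_k_inj gam0).
rewrite -(linear0 h) => /h_inj/esym.
by apply/eqP; exact: gen_neq0.
Qed.

Lemma V_gam_iso_class sigma tau gam gam' :
  iso (V_gam chi_n sigma gam) (V_gam chi_n tau gam') -> same_class chi tau sigma.
Proof.
rewrite !V_gam_cyclic => /cyclic_iso_weight[i ->].
by exists i => g /=; rewrite mulrC.
Qed.

End Deformed.

Section Classes.
Context {k : fieldType} {G : groupType} {chi : gchar k G}.
Implicit Types sigma tau : gchar k G.

Lemma same_class_refl sigma : same_class chi sigma sigma.
Proof. by exists 0 => g; rewrite expr0z mulr1. Qed.

(** An integral power of [chi] depends on its exponent modulo [n] only. *)
Lemma same_class_twist n sigma tau : gchar_order chi n ->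
  same_class chi sigma tau -> exists2 r, (r < n)%N & tau = gchar_twist chi r sigma.
Proof.
move=> chi_n [i iE]; have [n_gt0 chi_exp _] := chi_n.
have n0 : n%:Z != 0 by rewrite eqz_nat -lt0n.
exists `|(i %% n)%Z|%N; first by rewrite -ltz_nat gez0_abs ?modz_ge0 // ltz_pmod.
apply: gchar_ext => g; rewrite iE mulrC /= {1}(divz_eq i n).
rewrite expfzDr ?gchar_neq0 // [((i %/ n)%Z * n)]mulrC -exprz_exp -exprnP chi_exp.
by rewrite exp1rz mul1r exprnP gez0_abs ?modz_ge0.
Qed.

End Classes.

Theorem proposition4p22 (k : fieldType) (G : groupType) (chi : gchar k G)
    (a : G) (n : nat)
    (a_central : forall g : G, (a * g = g * a)%g)
    (chi_a : chi a != 1)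
    (n_ge2 : (2 <= n)%N)
    (chi_a_prim : n.-primitive_root (chi a)^-1) :
  (* (a) *)
  (let W' := in_W' (Hx chi ^+ n) in
   representative_set
     (fun i : nat * gchar k G => (1 <= i.1 <= n)%N)
     (fun i => V_t chi i.1 i.2)
     (fun M => fin_dim M /\ indecomposable W' M) /\
   (forall lam : gchar k G, projective W' (V_t chi n lam)))
  /\
  (* (b) *)
  (forall (beta : k) (beta_neq0 : beta != 0) (an_neq1 : (a ^+ n)%g != 1%g)
          (chi_n : gchar_order chi n),
   let W' := in_W' (Hx chi ^+ n - beta *: (1 - Hg chi a ^+ n)) in
   (forall R : gchar k G -> Prop,
      class_transversal chi (fun sigma => sigma a ^+ n != 1) R ->
      representative_set
        (fun i : nat * gchar k G + gchar k G =>
           match i with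
           | inl (t, lam) => (1 <= t <= n)%N /\ lam a ^+ n = 1
           | inr sigma => R sigma
           end)
        (fun i =>
           match i with
           | inl (t, lam) => V_t chi t lam
           | inr sigma => V_gam chi_n sigma (beta * (1 - sigma a ^+ n))
           end)
        (fun M => fin_dim M /\ indecomposable W' M)) /\
   (forall lam : gchar k G,
      projective W' (V_gam chi_n lam (beta * (1 - lam a ^+ n))))).

Proof.
have chi_a_neq1 i : (0 < i < n)%N -> chi a ^+ i != 1.
  case/andP=> i_gt0 lt_in; apply/eqP => chi_ai.
  have : (chi a)^-1 ^+ i == 1 by rewrite exprVn chi_ai invr1.
  by rewrite -(prim_order_dvd chi_a_prim) gtnNdvd.
case: n n_ge2 chi_a_prim chi_a_neq1 => // s _ _ chi_a_neq1.
split=> [W'|beta beta_neq0 an_neq1 chi_n W'].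
  split=> [|lam]; last first.
    rewrite V_t_cyclic; apply: cyclic_projective => [v|M m WM _].
      exact: (V_t_kill v).
    by rewrite (in_W'_kill WM) scale_k0.
  split=> [[t lam] /= |M [fdM indM]].
    case: t => // r /= lt_rs; rewrite V_t_cyclic.
    split; first exact: cyclic_fin_dim.
    apply: (cyclic_indecomposable (a := a)) => [i /andP[i0 ir]|v].
      by apply: chi_a_neq1; rewrite i0 (leq_trans ir).
    exact: (V_t_kill v).
  have [WM _ _] := indM.
  have [r [lam [lt_rs _ isoM]]] :=
    nilpotent_classification chi_a_neq1 fdM indM (in_W'_kill WM).
  exists (r.+1, lam); split=> // -[t' lam'] [/= /andP[t'_gt0 _] isoM'].
  by have [-> ->] := V_t_iso_inj (ltn0Sn r) t'_gt0 (iso_trans (iso_sym isoM) isoM').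
split=> [R [R_P R_unique]|lam]; last exact: V_gam_projective.
have scalar_neq0 (sigma : gchar k G) :
    sigma a ^+ s.+1 != 1 -> deform_scalar a s beta sigma != 0.
  by move=> sigma_an; rewrite mulf_neq0 // subr_eq0 eq_sym.
split=> [[[t lam] [t_n lam_an]|sigma _]|M [fdM indM]].
- exact: V_t_object.
- exact: V_gam_object.
have [WM _ _] := indM.
have [[sigma [m [ml m0 sigma_an]]]|all_an] := pselect (exists sigma (m : M),
    [/\ weight_vector sigma m, m != 0 & sigma a ^+ s.+1 != 1]).
  (* [x^r m] is a nonzero vector whose weight represents the class of [sigma]. *)
  have [tau [[Rtau st] _]] := R_unique sigma sigma_an.
  have [r lt_rn tauE] := same_class_twist chi_n st.
  have tau_scalar : deform_scalar a s beta tau = deform_scalar a s beta sigma.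
    by rewrite tauE deform_scalar_twist.
  have isoM : iso M (V_gam chi_n tau (deform_scalar a s beta tau)).
    apply: (V_gam_classification _ chi_a_neq1 (m := Hx chi ^+ r *: m)) => //.
    - by rewrite tauE; exact: weight_Hxn.
    - apply: contra_neq m0 => xrm; apply: (scale_k_inj (scalar_neq0 _ sigma_an)).
      rewrite -(Hxn_weight WM ml) scaler0 -(subnK (ltnW lt_rn)) exprD -scalerA.
      by rewrite xrm scaler0.
    - by rewrite tau_scalar scalar_neq0.
  exists (inr tau); split=> // -[[t' lam'] [[t'_n _] isoM']|tau' [Rtau' isoM']].
    case: (V_t_V_gam_not_iso t'_n _ (iso_trans (iso_sym isoM') isoM)).
    by rewrite tau_scalar scalar_neq0.
  have tt' := V_gam_iso_class (iso_trans (iso_sym isoM') isoM).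
  have [tau0 [_ uniq]] := R_unique tau (R_P _ Rtau).
  rewrite -(uniq tau') // -(uniq tau) //.
  by split=> //; exact: same_class_refl.
(* All weights of [M] are trivial on [a^n], so [x^n] is zero on [M]. *)
have an1 (lam : gchar k G) (m : M) : weight_vector lam m -> m != 0 -> lam a ^+ s.+1 = 1.
  move=> ml m0; apply/eqP/negPn/negP => lam_an; apply: all_an.
  by exists lam, m.
have xn0 (v : M) : Hx chi ^+ s.+1 *: v = 0.
  have [_ [span _]] := WM; have [N [mu [w [wmu ->]]]] := span v.
  rewrite scaler_sumr big1 // => i _.
  have [->|wi0] := eqVneq (w i) 0; first exact: scaler0.
  rewrite (Hxn_weight WM (wmu i)) /deform_scalar (an1 _ _ (wmu i) wi0).
  by rewrite subrr mulr0 scale_k0.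
have [r [lam [lt_rs [m ml m0] isoM]]] :=
  nilpotent_classification chi_a_neq1 fdM indM xn0.
exists (inl (r.+1, lam)); split=> [|].
  by split=> //; split=> //; exact: an1 ml m0.
case=> [[t' lam'] [[/andP[t'_gt0 _] _] isoM']|sigma [Rsigma isoM']].
  by have [-> ->] := V_t_iso_inj (ltn0Sn r) t'_gt0 (iso_trans (iso_sym isoM) isoM').
have isoV := iso_trans (iso_sym isoM) isoM'.
case: (V_t_V_gam_not_iso (_ : 0 < r.+1 <= s.+1)%N _ isoV) => //.
exact/scalar_neq0/R_P.
Qed.
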